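(* Let $A=(a_{nk})$ be an infinite real matrix and let $\bar{A}=(\bar a_{nk})$ be the associated matrix, $\bar a_{nk}=\sum_{j=k}^{\infty}\frac{f_{j+1}^{2}}{f_kf_{k+1}}a_{nj}$. Then: (a) If $A\in(\ell_1(\widehat F),\ell_\infty)$, then $$0\le \|L_A\|_\chi\le \limsup_{n\to\infty}\Big(\sup_{k}|\bar a_{nk}|\Big),$$ and $L_A$ is compact if $\lim_{n\to\infty}\big(\sup_k|\bar a_{nk}|\big)=0$. (b) If $A\in(\ell_1(\widehat F),c_0)$, then $$\|L_A\|_\chi= \limsup_{n\to\infty}\Big(\sup_{k}|\bar a_{nk}|\Big),$$ and $L_A$ is compact if and only if $\lim_{n\to\infty}\big(\sup_k|\bar a_{nk}|\big)=0$. (c) If $A\in(\ell_1(\widehat F),c)$, then $$\tfrac12\limsup_{n\to\infty}\Big(\sup_{k}|\bar a_{nk}-\bar\alpha_k|\Big)\le\|L_A\|_\chi\le \limsup_{n\to\infty}\Big(\sup_{k}|\bar a_{nk}-\bar\alpha_k|\Big),$$ and $L_A$ is compact if and only if $\lim_{n\to\infty}\big(\sup_k|\bar a_{nk}-\bar\alpha_k|\big)=0$, where $\bar\alpha_k=\lim_{n\to\infty}\bar a_{nk}$ for all $k\in\mathbb N$.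
   Context: $\mathbb N=\{0,1,2,\dots\}$; sums $\sum_k$ and suprema $\sup_k$ run over $k\in\mathbb N$. $\omega$ is the space of all real sequences $x=(x_k)_{k\in\mathbb N}$; $\ell_\infty$, $c$, $c_0$ are the spaces of bounded, convergent, null real sequences with the sup norm; $\ell_1$ is the usual space of absolutely summable real sequences with its usual norm. Fibonacci numbers: $f_0=f_1=1$, $f_n=f_{n-1}+f_{n-2}$ for $n\ge2$. For $x\in\omega$ the sequence $y=\widehat F x$ is given by $y_0=\frac{f_0}{f_1}x_0=x_0$ and $y_n=\frac{f_n}{f_{n+1}}x_n-\frac{f_{n+1}}{f_n}x_{n-1}$ for $n\ge1$. $\ell_1(\widehat F)=\{x\in\omega:\widehat F x\in\ell_1\}$, a Banach space with norm $\|x\|_{\ell_1(\widehat F)}=\|\widehat Fx\|_{\ell_1}$. For sequence spaces $X,Y$, $(X,Y)$ is the set of infinite real matrices $A=(a_{nk})_{n,k\in\mathbb N}$ such that for every $x\in X$ the series $A_n(x)=\sum_k a_{nk}x_k$ converges for every $n$ and $Ax=(A_n(x))_n\in Y$. For $A\in(X,Y)$, $L_A:X\to Y$ is the linear operator $L_A(x)=Ax$ (bounded for the spaces considered here). For $A\in(\ell_1(\widehat F),Y)$ the series defining $\bar a_{nk}$ converge for all $n,k$. Hausdorff measure of noncompactness: for a bounded subset $Q$ of a metric space $Y$, $\chi(Q)$ is the infimum of all $\varepsilon>0$ such that $Q$ is covered by finitely many balls $B(x_i,r_i)$ with centres $x_i\in Y$ and radii $r_i<\varepsilon$. For a bounded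 linear operator $L:X\to Y$ between Banach spaces, $\|L\|_\chi=\chi(L(S_X))$, where $S_X$ is the unit sphere of $X$ and $\chi$ is taken in $Y$. A linear operator $L:X\to Y$ defined on all of $X$ is compact if $L(Q)$ is totally bounded for every bounded $Q\subset X$. *)

(* Defs.v *)
From HB Require Import structures.
From mathcomp Require Import all_boot all_order all_algebra.
From mathcomp Require Import all_classical all_reals all_analysis.

Set Implicit Arguments.
Unset Strict Implicit.
Unset Printing Implicit Defensive.
Import Order.TTheory GRing.Theory Num.Theory.
Import numFieldNormedType.Exports.
Local Open Scope classical_set_scope.
Local Open Scope ring_scope.

Fixpoint fib (n : nat) : nat :=
  if n is m.+1 then (if m is l.+1 then (fib m + fib l)%N else 1%N) else 1%N.

(* A normed space of real sequences is given by its set of elements and its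
   norm; the value of [snorm] outside [elements] is never used. *)
Record seq_space (R : realType) := SeqSpace {
  elements : set (nat -> R);
  snorm : (nat -> R) -> R }.

Definition sup_norm (R : realType) (x : nat -> R) : R :=
  sup (range (fun k => `|x k|)).

Definition l1_norm (R : realType) (x : nat -> R) : R :=
  limn [normed series x].

Definition linfty (R : realType) : seq_space R :=
  SeqSpace [set x : nat -> R | bounded_fun x] (@sup_norm R).

Definition cspace (R : realType) : seq_space R :=
  SeqSpace [set x : nat -> R | cvgn x] (@sup_norm R).

Definition c0space (R : realType) : seq_space R :=
  SeqSpace [set x : nat -> R | x @ \oo --> (0 : R)] (@sup_norm R).

Definition l1space (R : realType) : seq_space R :=
  SeqSpace [set x : nat -> R | cvgn [normed series x]] (@l1_norm R).

Definition Fhat (R : realType) (x : nat -> R) (n : nat) : R :=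
  if n is m.+1 then
    (fib n)%:R / (fib n.+1)%:R * x n - (fib n.+1)%:R / (fib n)%:R * x m
  else (fib 0)%:R / (fib 1)%:R * x 0%N.

Definition l1F (R : realType) : seq_space R :=
  SeqSpace [set x : nat -> R | elements (l1space R) (Fhat x)]
    (fun x => snorm (l1space R) (Fhat x)).

(* The operator L_A on all sequences; its series converge on X when A belongs to the class (X, Y). *)
Definition mat_op (R : realType) (A : nat -> nat -> R) (x : nat -> R) :
    nat -> R :=
  fun n => limn (series (fun k => A n k * x k)).

Definition mat_class (R : realType) (X Y : seq_space R)
    (A : nat -> nat -> R) : Prop :=
  forall x, elements X x ->
    (forall n, cvgn (series (fun k => A n k * x k))) /\ elements Y (mat_op A x).

Definition abar (R : realType) (A : nat -> nat -> R) (n k : nat) : R :=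
  limn (fun N => \sum_(k <= j < N)
    (fib j.+1)%:R ^+ 2 / ((fib k)%:R * (fib k.+1)%:R) * A n j).

Definition alphabar (R : realType) (A : nat -> nat -> R) (k : nat) : R :=
  limn (fun n => abar A n k).

(* Extended-real valued, so that no boundedness of the rows is presupposed. *)
Definition row_sup (R : realType) (B : nat -> nat -> R) (n : nat) : \bar R :=
  ereal_sup (range (fun k => `|B n k|%:E)).

Definition sball (R : realType) (Y : seq_space R) (x : nat -> R) (r : R) :
    set (nat -> R) :=
  [set y | elements Y y /\ snorm Y (y \- x) < r].

Definition sbounded (R : realType) (X : seq_space R) (Q : set (nat -> R)) :
    Prop :=
  Q `<=` elements X /\ exists M : R, forall x, Q x -> snorm X x <= M.

Definition sphere (R : realType) (X : seq_space R) : set (nat -> R) :=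
  [set x | elements X x /\ snorm X x = 1].

Definition Hausdorff_mnc (R : realType) (Y : seq_space R)
    (Q : set (nat -> R)) : \bar R :=
  ereal_inf [set e%:E | e in [set e : R | 0 < e /\
    exists (m : nat) (c : 'I_m -> (nat -> R)) (r : 'I_m -> R),
      (forall i, elements Y (c i) /\ 0 < r i < e) /\
      Q `<=` \bigcup_(i in [set: 'I_m]) sball Y (c i) (r i)]].

Definition op_mnc (R : realType) (X Y : seq_space R)
    (L : (nat -> R) -> (nat -> R)) : \bar R :=
  Hausdorff_mnc Y (L @` sphere X).

Definition totally_bounded (R : realType) (Y : seq_space R)
    (Q : set (nat -> R)) : Prop :=
  forall e : R, 0 < e ->
    exists (m : nat) (c : 'I_m -> (nat -> R)),
      (forall i, elements Y (c i)) /\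
      Q `<=` \bigcup_(i in [set: 'I_m]) sball Y (c i) e.

Definition compact_op (R : realType) (X Y : seq_space R)
    (L : (nat -> R) -> (nat -> R)) : Prop :=
  forall Q : set (nat -> R), sbounded X Q -> totally_bounded Y (L @` Q).

(* Main.v *)
Require Import Defs.
From HB Require Import structures.
From mathcomp Require Import all_boot all_order all_algebra.
From mathcomp Require Import all_classical all_reals all_analysis.
From mathcomp Require Import ring lra.
Import Order.TTheory GRing.Theory Num.Theory.
Import numFieldNormedType.Exports.
Local Open Scope classical_set_scope.
Local Open Scope ring_scope.

(* Write y = Fhat x and S_N for the sum of f_{j+1}^2 a_{nj} over j < N.  Inverting Fhat
   gives x_n = f_{n+1}^2 sum_{k <= n} y_k / (f_k f_{k+1}), and summation by parts turns
   sum_{j < N} a_{nj} x_j into sum_{k < N} y_k (S_N - S_k) / (f_k f_{k+1}), so that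
   A_n x = sum_k abar_{nk} y_k with abar_{nk} = (S - S_k) / (f_k f_{k+1}); in particular
   every row of abar is bounded, without Banach-Steinhaus.

   Upper bounds: if |abar_{nk} - b_k| <= s for n >= N, then A x is within s of a sequence
   that is free on [0, N) and constant afterwards (with tail sum_k b_k y_k, b = 0 in (a)
   and (b)), and such bounded sequences have a finite net.  Lower bounds: abar_{.k} is
   the image of Fhat^-1 e_k, which has norm 1, so each column of abar lies in one of
   finitely many balls, whose centres converge. *)

(** * Inversion of [Fhat] and summation by parts *)

Lemma fib_gt0 (n : nat) : (0 < fib n)%N.
Proof.
suff /andP[] : ((0 < fib n) && (0 < fib n.+1))%N by [].
by elim: n => [//|n /andP[h1 h2]]; rewrite h2 /= addn_gt0 h2.
Qed.

Lemma fibR_neq0 (R : realType) (n : nat) : (fib n)%:R != 0 :> R.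
Proof. by rewrite pnatr_eq0 -lt0n fib_gt0. Qed.

(** The sum telescopes: for k >= 1, y_k / (f_k f_{k+1}) equals x_k / f_{k+1}^2 - x_{k-1} / f_k^2. *)
Lemma Fhat_inv (R : realType) (x : nat -> R) (n : nat) :
  x n = (fib n.+1)%:R ^+ 2 *
    \sum_(0 <= k < n.+1) Fhat x k / ((fib k)%:R * (fib k.+1)%:R).
Proof.
elim: n => [|n IH].
  by rewrite big_nat1 /= divr1 !mul1r divr1 expr1n mul1r.
have h0 := fibR_neq0 R n; have h1 := fibR_neq0 R n.+1.
have h2 := fibR_neq0 R n.+2.
have -> : \sum_(0 <= k < n.+2) Fhat x k / ((fib k)%:R * (fib k.+1)%:R) =
   x n / (fib n.+1)%:R ^+ 2 + Fhat x n.+1 / ((fib n.+1)%:R * (fib n.+2)%:R).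
  by rewrite big_nat_recr // IH [_ * \sum_(_ <= _ < _) _]mulrC mulfK ?expf_neq0.
rewrite [Fhat x n.+1]/Fhat; field.
by rewrite h1 h2.
Qed.

(** By [Fhat_inv], y_k meets the sum of f_{j+1}^2 a_j over k <= j < N; writing it as S_N - S_k lets
    N tend to infinity with k fixed. *)
Lemma sum_by_parts (R : realType) (a x : nat -> R) (N : nat) :
  \sum_(0 <= j < N) a j * x j =
  \sum_(0 <= k < N) Fhat x k / ((fib k)%:R * (fib k.+1)%:R) *
    (\sum_(0 <= j < N) (fib j.+1)%:R ^+ 2 * a j -
     \sum_(0 <= j < k) (fib j.+1)%:R ^+ 2 * a j).
Proof.
pose w k := Fhat x k / ((fib k)%:R * (fib k.+1)%:R).
pose S m := \sum_(0 <= j < m) (fib j.+1)%:R ^+ 2 * a j.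
have SS m : S m.+1 = S m + (fib m.+1)%:R ^+ 2 * a m by rewrite /S big_nat_recr.
have xE m : x m = (fib m.+1)%:R ^+ 2 * \sum_(0 <= k < m.+1) w k.
  exact: Fhat_inv.
change (\sum_(0 <= j < N) a j * x j = \sum_(0 <= k < N) w k * (S N - S k)).
elim: N => [|N IH]; first by rewrite !big_geq.
rewrite big_nat_recr // IH xE SS.
under [RHS]eq_bigr => k _ do rewrite addrAC mulrDr.
(* The new summand, k = N, carries S_N - S_N = 0. *)
rewrite /= big_split -big_distrl /= [X in _ = X + _]big_nat_recr //= subrr mulr0 addr0.
by congr (_ + _); rewrite mulrCA mulrA mulrC.
Qed.

Lemma bounded_funP (R : realType) (x : nat -> R) :
  bounded_fun x <-> exists M, forall n, `|x n| <= M.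
Proof.
split=> [[M [_ hM]]|[M hM]].
  by exists (M + 1) => n; apply: hM; rewrite ?ltrDl.
by exists M; split; rewrite ?num_real // => a Ma n _; apply: le_trans (hM n) (ltW Ma).
Qed.

(** * The rows of [abar] and the formula for A_n x *)

Section row.
Variables (R : realType) (A : nat -> nat -> R) (n : nat).
Let S N := \sum_(0 <= j < N) (fib j.+1)%:R ^+ 2 * A n j.
Hypothesis cS : cvgn S.

Lemma abar_tail k : abar A n k = (limn S - S k) / ((fib k)%:R * (fib k.+1)%:R).
Proof.
rewrite /abar; apply/cvg_lim => //.
have : (S N - S k) / ((fib k)%:R * (fib k.+1)%:R) @[N --> \oo] -->
    (limn S - S k) / ((fib k)%:R * (fib k.+1)%:R).
  by apply: cvgMl; apply: cvgB => //; exact: cvg_cst.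
(* The equality is only eventual: for N < k the sum from k to N is empty, while S_N - S_k need not
   vanish. *)
apply: cvg_trans; apply: near_eq_cvg.
near=> N.
have kN : (k <= N)%N by near: N; exact: nbhs_infty_ge.
have -> : S N - S k = \sum_(k <= j < N) (fib j.+1)%:R ^+ 2 * A n j.
  by rewrite /S (big_cat_nat _ kN) //= addrAC subrr add0r.
rewrite big_distrl /=.
by apply: eq_bigr => j _; rewrite mulrAC.
Unshelve. all: by end_near. Qed.

(** S converges, hence is bounded, and the denominator f_k f_{k+1} is at least 1. *)
Lemma abar_bounded : exists M, forall k, `|abar A n k| <= M.
Proof.
have [M hM] := (bounded_funP _ _).1 (cvg_seq_bounded cS).
exists (`|limn S| + M) => k; rewrite abar_tail normrM.
have h1 : 1 <= (fib k)%:R * (fib k.+1)%:R :> R.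
  by rewrite -natrM (ler_nat _ 1) muln_gt0 !fib_gt0.
have h0 := lt_le_trans ltr01 h1.
rewrite normfV (gtr0_norm h0) ler_pdivrMr //.
apply: le_trans (ler_peMr _ h1); last by rewrite addr_ge0 // (le_trans _ (hM 0%N)).
by rewrite (le_trans (ler_normB _ _)) // lerD2l hM.
Qed.
End row.

Lemma l1_norm_ge0 (R : realType) (x : nat -> R) : 0 <= l1_norm x.
Proof.
(* For a divergent series [limn] is the default value 0. *)
rewrite /l1_norm; have [cx|/dvgP ->//] := pselect (cvgn [normed series x]).
by apply: limr_ge => //; apply: nearW => N; apply: sumr_ge0 => i _; exact: normr_ge0.
Qed.

(** Hölder's inequality for l_infty and l_1, by comparison with s |y_k|. *)
Lemma pairing_le (R : realType) (b y : nat -> R) (s : R) :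
    cvgn [normed series y] -> (forall k, `|b k| <= s) ->
  cvgn (series (fun k => b k * y k)) /\
  `|limn (series (fun k => b k * y k))| <= s * l1_norm y.
Proof.
move=> cy bs; have s0 : 0 <= s by rewrite (le_trans _ (bs 0%N)).
have csy : cvgn (series (s *: (fun k => `|y k|))) by exact: is_cvg_seriesZ.
have le k : `|b k * y k| <= (s *: (fun k => `|y k|)) k.
  by rewrite normrM ler_wpM2r.
have cby : cvgn [normed series (fun k => b k * y k)].
  apply: (series_le_cvg _ _ le csy) => k; first exact: normr_ge0.
  exact: le_trans (normr_ge0 _) (le k).
split; first exact: normed_cvg.
apply: (le_trans (lim_series_norm cby)).
rewrite -[s * l1_norm y]/(s *: limn (series (fun k => `|y k|))) -lim_seriesZ //.
exact: lim_series_le.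
Qed.

(** The partial sums of the two series differ by (S_N - lim S) times the partial sum of [w]; the
    first factor tends to 0 and the second converges, since 1 / (f_k f_{k+1}) <= 1. *)
Lemma mat_op_abar (R : realType) (A : nat -> nat -> R) (x : nat -> R) (n : nat) :
    cvgn (fun N => \sum_(0 <= j < N) (fib j.+1)%:R ^+ 2 * A n j) ->
    elements (l1F R) x ->
  mat_op A x n = limn (series (fun k => abar A n k * Fhat x k)).
Proof.
move=> cS cx; have [M hM] := abar_bounded R A n cS.
have [cB _] := pairing_le R _ _ _ cx hM.
set S := (fun N => _) in cS.
pose w k := Fhat x k / ((fib k)%:R * (fib k.+1)%:R).
have cw : cvgn (series w).
  have [] := pairing_le R (fun k => ((fib k)%:R * (fib k.+1)%:R)^-1) _ 1 cx.
    move=> k; have h1 : 1 <= (fib k)%:R * (fib k.+1)%:R :> R.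
      by rewrite -natrM (ler_nat _ 1) muln_gt0 !fib_gt0.
    by rewrite ger0_norm ?invr_ge0 ?(le_trans ler01 h1) // invf_le1 // (lt_le_trans ltr01 h1).
  by under eq_fun do rewrite mulrC.
apply/cvg_lim => //.
have -> : series (fun k => A n k * x k) =
    series (fun k => abar A n k * Fhat x k) \+ (fun N => (S N - limn S) * series w N).
  apply/funext => N; rewrite /series /= sum_by_parts big_distrr -big_split /=.
  apply: eq_bigr => k _; rewrite (abar_tail R A n cS) -/(S N) -/(S k) /w; ring.
rewrite -[X in _ --> X]addr0; apply: cvgD => //.
rewrite -[X in _ --> X](mul0r (limn (series w))); apply: cvgM => //.
by rewrite -(subrr (limn S)); apply: cvgB => //; exact: cvg_cst.
Qed.

(** * Preimages of the unit vectors *)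

Definition unit_seq (R : realType) (k j : nat) : R := (j == k)%:R.

(* Fhat^-1 e_k *)
Definition Fhat_basis (R : realType) (k j : nat) : R :=
  if (k <= j)%N then (fib j.+1)%:R ^+ 2 / ((fib k)%:R * (fib k.+1)%:R) else 0.

Lemma Fhat_basisE (R : realType) (k : nat) : Fhat (Fhat_basis R k) = unit_seq R k.
Proof.
apply/funext => -[|j].
  rewrite /Fhat /Fhat_basis /unit_seq; case: k => [|k] /=; first by rewrite expr1n !mul1r !invr1 mulr1.
  by rewrite mulr0.
have h0 := fibR_neq0 R j; have h1 := fibR_neq0 R j.+1; have h2 := fibR_neq0 R j.+2.
rewrite /Fhat /Fhat_basis /unit_seq.
have [jk|kj|<-] := ltngtP j.+1 k.
- by rewrite leqNgt (ltnW jk) /= !mulr0 subrr.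
(* For k <= j both terms are f_{j+1} f_{j+2} / (f_k f_{k+1}) and cancel. *)
- rewrite -ltnS kj; apply/eqP; rewrite subr_eq0; apply/eqP; field.
  by rewrite h1 h2 !fibR_neq0.
- by rewrite ltnn mulr0 subr0; transitivity (1 : R) => //; field; rewrite h1 h2.
Qed.

Lemma series_unit_seq (R : realType) (k : nat) (N : nat) : (k < N)%N ->
  [normed series (unit_seq R k)] N = 1.
Proof.
move=> kN; rewrite /normed_series_of seriesEnat /= (bigD1_seq k) ?mem_index_iota ?iota_uniq //=.
rewrite /unit_seq eqxx normr1 big1 ?addr0 // => j /negbTE ->.
by rewrite normr0.
Qed.

Lemma Fhat_basis_sphere (R : realType) (k : nat) : sphere (l1F R) (Fhat_basis R k).
Proof.
have h : [normed series (unit_seq R k)] @ \oo --> (1 : R).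
  apply: cvg_near_cst; near=> N; apply: series_unit_seq.
  by near: N; exact: nbhs_infty_gt.
split; rewrite /= Fhat_basisE; first by apply/cvg_ex; exists 1.
exact/cvg_lim.
Unshelve. all: by end_near. Qed.

(** [Fhat_basis R k] carries exactly the weights of [abar], so the partial sums agree for every N;
    both vanish for N <= k. *)
Lemma mat_op_basis (R : realType) (A : nat -> nat -> R) (n k : nat) :
  mat_op A (Fhat_basis R k) n = abar A n k.
Proof.
rewrite /mat_op /abar; congr (limn _); apply/funext => N.
rewrite /series /= [LHS](bigID (fun j => (k <= j)%N)) /= addrC big1 ?add0r; last first.
  by move=> j /negbTE kj; rewrite /Fhat_basis kj mulr0.
have [kN|Nk] := leqP k N; last first.
  rewrite [RHS]big_geq 1?ltnW // big_nat_cond big1 // => j /andP[/andP[_ jN] kj].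
  by have := leq_ltn_trans kj (ltn_trans jN Nk); rewrite ltnn.
rewrite (big_cat_nat _ kN) //= [X in X + _]big_nat_cond big1 ?add0r; last first.
  by move=> j /andP[/andP[_ jk]]; rewrite leqNgt jk.
rewrite [LHS]big_nat_cond [RHS]big_nat; apply: eq_big => j.
  by case: (leqP k j) => //=; rewrite andbT.
by move=> /andP[/andP[kj _] _]; rewrite /Fhat_basis kj mulrC.
Qed.

(** * Finite nets for the sup norm *)

Lemma sup_norm_le (R : realType) (x : nat -> R) (s : R) :
  (forall n, `|x n| <= s) -> sup_norm x <= s.
Proof.
move=> xs; apply: ge_sup; first by exists `|x 0%N|, 0%N.
by move=> _ [n _ <-].
Qed.

Lemma le_sup_norm (R : realType) (x : nat -> R) (n : nat) :
  bounded_fun x -> `|x n| <= sup_norm x.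
Proof.
move=> /bounded_funP[M hM]; apply: ub_le_sup; last by exists n.
by exists M => _ [k _ <-].
Qed.

(** Only N + 1 coordinates matter, so a grid of mesh d on [-M, M] in each of them is finite; its
    points are coded by functions into ['I_K.+1]. *)
Lemma grid_net (R : realType) (M d : R) (N : nat) : 0 < d ->
  exists (m : nat) (g : 'I_m -> nat -> R), forall p : nat -> R,
    (forall n, (n <= N)%N -> `|p n| <= M) ->
    exists i, forall n, (n <= N)%N -> `|p n - g i n| <= d.
Proof.
move=> d0; pose K := Num.trunc ((M + M) / d).
exists #|{ffun 'I_N.+1 -> 'I_K.+1}|.
exists (fun i n => d * ((enum_val i : {ffun 'I_N.+1 -> 'I_K.+1}) (inord n))%:R - M) => p pM.
(* Each coordinate is rounded down to the grid. *)
exists (enum_rank [ffun n : 'I_N.+1 => inord (Num.trunc ((p n + M) / d))]) => n nN.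
have /andP[pl pu] : - M <= p n <= M by rewrite -ler_norml pM.
have nN' : (n < N.+1)%N by [].
rewrite enum_rankK ffunE (inordK nN') inordK; last first.
  by rewrite ltnS; apply: le_truncn; rewrite ler_pM2r ?invr_gt0 // lerD2r.
have /andP[tl tu] : (Num.trunc ((p n + M) / d))%:R <= (p n + M) / d
    < (Num.trunc ((p n + M) / d)).+1%:R.
  by apply: truncn_itv; rewrite divr_ge0 ?(ltW d0) // -lerBlDr sub0r.
rewrite ler_pdivlMr // mulrC in tl; rewrite ltr_pdivrMr // mulrC -natr1 mulrDr mulr1 in tu.
by rewrite ler_norml; lra.
Qed.

(* [th] is 0 when the centres must lie in c_0, and 1 when they only have to converge. *)
Definition step_seq (R : realType) (th : R) (N : nat) (p : nat -> R) (n : nat) : R :=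
  if (n < N)%N then p n else th * p N.

(** Step sequences depend on p_0, ..., p_N alone, so a grid of mesh (r - s) / 2 supplies the centres
    and keeps the total error below r; |th| <= 1 prevents the grid error from growing in the
    tail. *)
Lemma step_cover (R : realType) (E Q : set (nat -> R)) (th M s r : R) (N : nat) :
    `|th| <= 1 -> s < r -> Q `<=` E ->
    (forall p, E (step_seq R th N p)) ->
    (forall z, Q z -> exists2 p, forall n, (n <= N)%N -> `|p n| <= M &
       forall n, `|z n - step_seq R th N p n| <= s) ->
  exists (m : nat) (c : 'I_m -> nat -> R), (forall i, E (c i)) /\
    Q `<=` \bigcup_(i in [set: 'I_m]) sball (SeqSpace E (@sup_norm R)) (c i) r.
Proof.
move=> th1 sr QE Estep Qstep.
have d0 : 0 < (r - s) / 2 by rewrite divr_gt0 ?subr_gt0.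
have [m [g gP]] := grid_net R M _ N d0.
exists m, (fun i => step_seq R th N (g i)); split=> [i|z Qz]; first exact: Estep.
have [p pM zp] := Qstep z Qz; have [i pg] := gP p pM.
exists i => //; split; first exact: QE.
apply: (@le_lt_trans _ _ (s + (r - s) / 2)); last by lra.
apply: sup_norm_le => n /=.
rewrite -(subrKA (step_seq R th N p n)); apply: (le_trans (ler_normD _ _)).
apply: lerD; first exact: zp.
rewrite /step_seq; case: ltnP => nN; first exact/pg/ltnW.
rewrite -mulrBr normrM; apply: le_trans (pg N (leqnn N)).
by rewrite ler_piMl.
Qed.

(** * Finite covers of images under L_A *)

Lemma mat_class_row (R : realType) (Y : seq_space R) (A : nat -> nat -> R) (n : nat) :
    mat_class (l1F R) Y A ->
  cvgn (fun N => \sum_(0 <= j < N) (fib j.+1)%:R ^+ 2 * A n j).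
Proof.
(* [Fhat_basis R 0] has the entries f_{j+1}^2, so S is the series of A_n at this element. *)
move=> /(_ _ (Fhat_basis_sphere R 0).1)[/(_ n) cA _].
set S := (fun N => _); suff -> : S = series (fun j => A n j * Fhat_basis R 0 j) by [].
apply/funext => N; rewrite /series /=.
by apply: eq_bigr => j _; rewrite /Fhat_basis /= mulr1 divr1 mulrC.
Qed.

(** Applied with b = 0, th = 0 for l_infty and c_0, and with b = [alphabar A], th = 1 for c. The
    condition th b_k = b_k ensures that scaling by th leaves the tail value sum_k b_k y_k
    unchanged. *)
Lemma mat_op_cover (R : realType) (E Q : set (nat -> R)) (A : nat -> nat -> R)
    (b : nat -> R) (th s M r : R) (N : nat) :
    mat_class (l1F R) (SeqSpace E (@sup_norm R)) A ->
    `|th| <= 1 -> (forall k, th * b k = b k) ->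
    (forall p, E (step_seq R th N p)) ->
    (forall n k, (N <= n)%N -> `|abar A n k - b k| <= s) -> s * M < r ->
    Q `<=` elements (l1F R) -> (forall x, Q x -> snorm (l1F R) x <= M) ->
  exists (m : nat) (c : 'I_m -> nat -> R), (forall i, E (c i)) /\
    mat_op A @` Q `<=` \bigcup_(i in [set: 'I_m])
      sball (SeqSpace E (@sup_norm R)) (c i) r.
Proof.
move=> AE th1 thb Estep As sMr QX QM.
have cS n := mat_class_row R _ A n AE.
have [B hB] := choice (fun n => abar_bounded R A n (cS n)).
have B0 n : 0 <= B n by rewrite (le_trans _ (hB n 0%N)).
have s0 : 0 <= s by rewrite (le_trans _ (As N 0%N (leqnn N))).
(* Closeness to row N alone bounds b. *)
have hb k : `|b k| <= B N + s.
  have -> : b k = abar A N k - (abar A N k - b k) by ring.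
  by rewrite (le_trans (ler_normB _ _)) // lerD // As.
(* C dominates b and the rows n < N, so C M bounds p_0, ..., p_N. *)
pose C := \sum_(0 <= n < N) B n + (B N + s).
have C0 : 0 <= C by rewrite !addr_ge0 // sumr_ge0.
apply: (@step_cover _ _ _ th (C * M) (s * M)) => // [_ [x Qx <-]|_ [x Qx <-]].
  by have [_] := AE x (QX x Qx).
have cx := QX x Qx; have xM := QM x Qx; have n0 := l1_norm_ge0 R (Fhat x).
have [cb lb] := pairing_le R _ _ _ cx hb.
(* The first N coordinates copy A x; coordinate N stores the tail value. *)
exists (fun n => if (n < N)%N then mat_op A x n
  else limn (series (fun k => b k * Fhat x k))) => n.
  move=> nN; case: ltnP => [{}nN|_]; last first.
    apply: (le_trans lb); apply: ler_pM => //; first by rewrite addr_ge0.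
    by rewrite lerDr sumr_ge0.
  rewrite mat_op_abar //; apply: (le_trans (pairing_le R _ _ _ cx (hB n)).2).
  apply: ler_pM => //.
  rewrite /C (bigD1_seq n) ?mem_index_iota ?iota_uniq //= -addrA lerDl.
  by rewrite !addr_ge0 // sumr_ge0.
rewrite /step_seq ltnn; case: ltnP => nN.
  by rewrite subrr normr0 mulr_ge0 // (le_trans n0).
have -> : th * limn (series (fun k => b k * Fhat x k)) =
    limn (series (fun k => b k * Fhat x k)).
  rewrite -[LHS]/(th *: _) -lim_seriesZ //; congr (limn (series _)).
  by apply/funext => k; rewrite -[LHS]/(th * _) mulrA thb.
(* From N on, the error is the pairing of the row differences with y. *)
rewrite mat_op_abar // -lim_seriesB //; last exact: (pairing_le R _ _ _ cx (hB n)).1.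
have -> : (fun k => abar A n k * Fhat x k) - (fun k => b k * Fhat x k) =
    (fun k => (abar A n k - b k) * Fhat x k).
  by apply/funext => k; rewrite mulrBl.
apply: (le_trans (pairing_le R _ _ s cx _).2); first by move=> k; exact: As.
exact: ler_wpM2l.
Qed.

(** * Row suprema and limits superior *)

Lemma row_sup_ge0 (R : realType) (B : nat -> nat -> R) (n : nat) : (0 <= row_sup B n)%E.
Proof.
apply: (@le_trans _ _ `|B n 0%N|%:E); first by rewrite lee_fin.
by apply: ereal_sup_ubound; exists 0%N.
Qed.

Lemma row_sup_leP (R : realType) (B : nat -> nat -> R) (n : nat) (s : R) :
  (row_sup B n <= s%:E)%E <-> forall k, `|B n k| <= s.
Proof.
split=> [h k|h].
  by rewrite -lee_fin; apply: le_trans h; apply: ereal_sup_ubound; exists k.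
by apply: ge_ereal_sup => _ [k _ <-]; rewrite lee_fin.
Qed.

Lemma limn_esup_ge0 (R : realType) (u : nat -> \bar R) :
  (forall n, (0 <= u n)%E) -> (0 <= limn_esup u)%E.
Proof.
by move=> u0; apply: limf_esup_ge0 => // -[n _] /(_ n (leqnn n)).
Qed.

Lemma limn_esup_le (R : realType) (u : nat -> \bar R) (a : \bar R) :
  (\forall n \near \oo, (u n <= a)%E) -> (limn_esup u <= a)%E.
Proof.
move=> ua; apply: (@le_trans _ _ (ereal_sup (u @` [set n | (u n <= a)%E]))).
  by apply: ereal_inf_lbound; exists [set n | (u n <= a)%E].
by apply: ge_ereal_sup => _ [n ? <-].
Qed.

(** The limit superior is an infimum over neighbourhoods of infinity, so one of them already has its
    supremum below a. *)
Lemma limn_esup_lt (R : realType) (u : nat -> \bar R) (a : \bar R) :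
  (limn_esup u < a)%E -> exists N, forall n, (N <= n)%N -> (u n <= a)%E.
Proof.
move=> /ereal_inf_lt[_ [V [N _ NV] <-]] Va; exists N => n Nn.
by apply: le_trans (ltW Va); apply: ereal_sup_ubound; exists n => //; exact: NV.
Qed.

Lemma op_mnc_ge0 (R : realType) (X Y : seq_space R) (L : (nat -> R) -> nat -> R) :
  (0 <= op_mnc X Y L)%E.
Proof.
by apply: le_ereal_inf_tmp => _ [e [e0 _] <-]; rewrite lee_fin ltW.
Qed.

Lemma totally_bounded_mnc (R : realType) (Y : seq_space R) (Q : set (nat -> R)) :
  totally_bounded Y Q -> (Hausdorff_mnc Y Q <= 0)%E.
Proof.
move=> tQ; apply/lee_addgt0Pr => e e0; rewrite add0e.
apply: ereal_inf_lbound; exists e => //; split=> //.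
(* Radii have to be strictly below e, whence e / 2. *)
have e20 : 0 < e / 2 by rewrite divr_gt0.
have [m [c [cY Qc]]] := tQ _ e20; exists m, c, (fun=> e / 2); split=> // i.
by split=> //; rewrite e20 ltr_pdivrMr // ltr_pMr ?ltr1n.
Qed.

(** * Upper bounds and sufficiency for compactness *)

Section upper.
Variables (R : realType) (E : set (nat -> R)) (A : nat -> nat -> R).
Variables (b : nat -> R) (th : R).
Let Y := SeqSpace E (@sup_norm R).
Let rs := row_sup (fun n k => (abar A n k - b k)%R).
Hypotheses (AE : mat_class (l1F R) Y A) (th1 : `|th| <= 1).
Hypotheses (thb : forall k, th * b k = b k).
Hypothesis Estep : forall N p, E (step_seq R th N p).

Lemma op_mnc_le : (op_mnc (l1F R) Y (mat_op A) <= limn_esup rs)%E.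
Proof.
have := limn_esup_ge0 R rs (row_sup_ge0 R _).
(* An infinite limit superior makes the bound trivial. *)
case l_eq : (limn_esup rs) => [l| |] h0; [move: h0|by rewrite leey|by []].
rewrite lee_fin => l0; apply/lee_addgt0Pr => e e0.
(* Here l + e/3 bounds the rows, l + e/2 is the radius and l + e the admissible value; each step up
   must be strict. *)
have [N hN] : exists N, forall n, (N <= n)%N -> (rs n <= (l + e / 3)%:E)%E.
  by apply: limn_esup_lt; rewrite l_eq lte_fin; lra.
have [||||m [c [cE Qc]]] :=
  mat_op_cover R E (sphere (l1F R)) A b th (l + e / 3) 1 (l + e / 2) N AE th1 thb (Estep N).
- by move=> n k /hN /row_sup_leP.
- by lra.
- by move=> x [].
- by move=> x [_ ->].
rewrite -EFinD; apply: ereal_inf_lbound; exists (l + e) => //; split; first by lra.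
exists m, c, (fun=> l + e / 2); split=> // i; split; first exact: cE.
by apply/andP; split; lra.
Qed.

Lemma compact_of_cvg : rs @ \oo --> 0%E -> compact_op (l1F R) Y (mat_op A).
Proof.
move=> /cvg_limn_einf_sup[_ l0] Q [QX [M QM]] e e0.
(* M need not be positive; M' is a norm bound that can be divided by. *)
pose M' := `|M| + 1; have M0 : 0 < M' by rewrite /M' ltr_wpDl.
have [N hN] : exists N, forall n, (N <= n)%N -> (rs n <= (e / 2 / M')%:E)%E.
  by apply: limn_esup_lt; rewrite l0 lte_fin !divr_gt0.
apply: (mat_op_cover R E Q A b th (e / 2 / M') M' e N) => //.
- by move=> n k /hN /row_sup_leP.
- by rewrite divfK ?gt_eqF //; lra.
- by move=> x /QM xM; rewrite (le_trans xM) // (le_trans (ler_norm M)) // /M' lerDl.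
Qed.
End upper.

(** * Lower bounds from a finite cover *)

Lemma sphere_cover_row (R : realType) (E : set (nat -> R)) (A : nat -> nat -> R)
    (m : nat) (c : 'I_m -> nat -> R) (r : 'I_m -> R) (e : R) :
    E `<=` [set x | bounded_fun x] -> (forall i, E (c i) /\ 0 < r i < e) ->
    mat_op A @` sphere (l1F R) `<=` \bigcup_(i in [set: 'I_m])
      sball (SeqSpace E (@sup_norm R)) (c i) (r i) ->
  forall k, exists i, forall n, `|abar A n k - c i n| <= e.
Proof.
move=> Eb cE cov k.
(* The image of [Fhat_basis R k] is the whole column k, so the ball containing it gives one index i
   for all n. *)
have [|i _ [/= EA Ai]] := cov (mat_op A (Fhat_basis R k)).
  by exists (Fhat_basis R k) => //; exact: Fhat_basis_sphere.
exists i => n; have [Ec /andP[_ re]] := cE i.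
rewrite -mat_op_basis; apply: ltW; apply: le_lt_trans re; apply: ltW; apply: le_lt_trans Ai.
apply: (@le_sup_norm _ (mat_op A (Fhat_basis R k) \- c i)).
have /bounded_funP[M1 h1] := Eb _ EA; have /bounded_funP[M2 h2] := Eb _ Ec.
apply/bounded_funP; exists (M1 + M2) => j /=.
by rewrite (le_trans (ler_normB _ _)) // lerD.
Qed.

(** There are finitely many centres, so from some n on all are within d of their limits at once,
    with a threshold independent of k. *)
Lemma limn_esup_row_sup_le (R : realType) (A : nat -> nat -> R) (b : nat -> R)
    (m : nat) (c : 'I_m -> nat -> R) (l : 'I_m -> R) (e e' : R) :
    (forall i, c i @ \oo --> l i) ->
    (forall k, exists i, (forall n, `|abar A n k - c i n| <= e) /\ `|b k - l i| <= e') ->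
  (limn_esup (row_sup (fun n k => (abar A n k - b k)%R)) <= (e + e')%:E)%E.
Proof.
move=> cl cov; apply/lee_addgt0Pr => d d0; rewrite -EFinD.
apply: limn_esup_le.
have : \forall n \near \oo, forall i, `|l i - c i n| <= d.
  apply: filter_forall => i; have /cvgrPdist_le := cl i; exact.
apply: filterS => n hn; apply/row_sup_leP => k.
have [i [Ac bl]] := cov k.
have -> : abar A n k - b k = (abar A n k - c i n) + ((l i - b k) - (l i - c i n)) by ring.
rewrite (le_trans (ler_normD _ _)) // -[leRHS]addrA lerD //.
by rewrite (le_trans (ler_normB _ _)) // lerD // distrC.
Qed.

Lemma cvg_step_seq (R : realType) (th : R) (N : nat) (p : nat -> R) :
  step_seq R th N p @ \oo --> th * p N.
Proof.
apply: cvg_near_cst; near=> n; rewrite /step_seq ltnNge.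
suff -> : (N <= n)%N by [].
by near: n; exact: nbhs_infty_ge.
Unshelve. all: by end_near. Qed.

Lemma sub_c0space_cspace (R : realType) : elements (c0space R) `<=` elements (cspace R).
Proof. by move=> x /= x0; apply/cvg_ex; exists 0. Qed.

Lemma sub_cspace_linfty (R : realType) : elements (cspace R) `<=` elements (linfty R).
Proof. by move=> x; exact: cvg_seq_bounded. Qed.

Lemma row_sup_subr0 (R : realType) (A : nat -> nat -> R) :
  row_sup (abar A) = row_sup (fun n k => (abar A n k - 0)%R).
Proof.
by congr row_sup; apply/funext => n; apply/funext => k; rewrite subr0.
Qed.

(** Centres in c_0 have limit 0, so comparing limits costs nothing and no factor 2 appears. *)
Lemma c0_row_sup_le (R : realType) (A : nat -> nat -> R)
    (m : nat) (c : 'I_m -> nat -> R) (r : 'I_m -> R) (e : R) :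
    (forall i, elements (c0space R) (c i) /\ 0 < r i < e) ->
    mat_op A @` sphere (l1F R) `<=` \bigcup_(i in [set: 'I_m])
      sball (c0space R) (c i) (r i) ->
  (limn_esup (row_sup (abar A)) <= e%:E)%E.
Proof.
move=> cE cov; rewrite row_sup_subr0 -[e]addr0.
apply: (limn_esup_row_sup_le R A (fun=> 0) m c (fun=> 0)) => [i|k].
  by have [] := cE i.
have [i Ac] := sphere_cover_row R _ A m c r e
  (subset_trans (@sub_c0space_cspace R) (@sub_cspace_linfty R)) cE cov k.
by exists i; rewrite subrr normr0.
Qed.

(** Letting n tend to infinity in |abar_{nk} - c_i(n)| <= e bounds |alphabar_k - lim c_i| by e as
    well; the two errors add up to 2e, the source of the factor 1/2. *)
Lemma c_row_sup_le (R : realType) (A : nat -> nat -> R)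
    (m : nat) (c : 'I_m -> nat -> R) (r : 'I_m -> R) (e : R) :
    mat_class (l1F R) (cspace R) A ->
    (forall i, elements (cspace R) (c i) /\ 0 < r i < e) ->
    mat_op A @` sphere (l1F R) `<=` \bigcup_(i in [set: 'I_m])
      sball (cspace R) (c i) (r i) ->
  (limn_esup (row_sup (fun n k => (abar A n k - alphabar A k)%R)) <= (2 * e)%:E)%E.
Proof.
move=> AE cE cov; rewrite mulr_natl mulr2n.
apply: (limn_esup_row_sup_le R A _ m c (fun i => limn (c i))) => [i|k].
  by have [] := cE i.
have [i Ac] := sphere_cover_row R _ A m c r e (@sub_cspace_linfty R) cE cov k.
exists i; split=> //.
(* The column limit exists because the column is an image under A and so lies in c. *)
have ca : abar A ^~ k @ \oo --> alphabar A k.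
  have [_ +] := AE _ (Fhat_basis_sphere R k).1.
  by congr (cvg (_ @ \oo)); apply/funext => n; exact: mat_op_basis.
have : (fun n => `|abar A n k - c i n|) @ \oo --> `|alphabar A k - limn (c i)|.
  by apply: cvg_norm; apply: cvgB => //; have [] := cE i.
by move=> /cvgr_to_le; apply; exact: nearW.
Qed.

(** * The three target spaces *)

Theorem theorem3p4 (R : realType) (A : nat -> nat -> R) :
  (* (a) *)
  (mat_class (l1F R) (linfty R) A ->
     [/\ (0 <= op_mnc (l1F R) (linfty R) (mat_op A))%E,
         (op_mnc (l1F R) (linfty R) (mat_op A) <=
            limn_esup (row_sup (abar A)))%E
       & (row_sup (abar A) @ \oo --> 0%E ->
          compact_op (l1F R) (linfty R) (mat_op A))]) /\
  (* (b) *)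
  (mat_class (l1F R) (c0space R) A ->
     op_mnc (l1F R) (c0space R) (mat_op A) = limn_esup (row_sup (abar A)) /\
     (compact_op (l1F R) (c0space R) (mat_op A) <->
      row_sup (abar A) @ \oo --> 0%E)) /\
  (* (c) *)
  (mat_class (l1F R) (cspace R) A ->
     [/\ ((2^-1)%:E * limn_esup (row_sup (fun n k => (abar A n k - alphabar A k)%R)) <=
            op_mnc (l1F R) (cspace R) (mat_op A))%E,
         (op_mnc (l1F R) (cspace R) (mat_op A) <=
            limn_esup (row_sup (fun n k => (abar A n k - alphabar A k)%R)))%E
       & (compact_op (l1F R) (cspace R) (mat_op A) <->
          row_sup (fun n k => (abar A n k - alphabar A k)%R) @ \oo --> 0%E)]).
Proof.
(* For th = 0 step sequences are null, hence lie in all three spaces; for th = 1 they converge,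
   which suffices in (c). *)
have step0 N p : elements (c0space R) (step_seq R 0 N p).
  by rewrite /= -[X in _ --> X](mul0r (p N)); exact: cvg_step_seq.
have step1 N p : elements (cspace R) (step_seq R 1 N p).
  by apply/cvg_ex; exists (1 * p N); exact: cvg_step_seq.
have n0 : `|0 : R| <= 1 by rewrite normr0.
have n1 : `|1 : R| <= 1 by rewrite normr1.
have b0 (k : nat) : (0 : R) * 0 = 0 by rewrite mul0r.
split; [|split] => AE.
- have stepb N p : elements (linfty R) (step_seq R 0 N p).
    exact/sub_cspace_linfty/sub_c0space_cspace.
  rewrite row_sup_subr0; split; first exact: op_mnc_ge0.
    exact: (@op_mnc_le R _ A (fun=> 0) 0).
  exact: (@compact_of_cvg R _ A (fun=> 0) 0).
- have le : (limn_esup (row_sup (abar A)) <=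
      op_mnc (l1F R) (c0space R) (mat_op A))%E.
    apply: le_ereal_inf_tmp => _ [e [_ [m [c [r [cE cov]]]]] <-].
    exact: c0_row_sup_le cE cov.
  split.
    apply/eqP; rewrite eq_le le andbT row_sup_subr0.
    exact: (@op_mnc_le R _ A (fun=> 0) 0).
  split=> [cA|]; last first.
    by rewrite row_sup_subr0; exact: (@compact_of_cvg R _ A (fun=> 0) 0).
  (* Compactness makes the image of the sphere totally bounded, so the limit superior is at most 0;
     nonnegative row suprema then tend to 0. *)
  apply: limn_esup_le_cvg; last exact: row_sup_ge0.
  apply: (le_trans le); apply: totally_bounded_mnc; apply: cA.
  by split=> [x []//|]; exists 1 => x [_ ->].
- have le : ((2^-1)%:E * limn_esup (row_sup (fun n k => (abar A n k - alphabar A k)%R)) <=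
      op_mnc (l1F R) (cspace R) (mat_op A))%E.
    apply: le_ereal_inf_tmp => _ [e [_ [m [c [r [cE cov]]]]] <-].
    by rewrite lee_pdivrMl // -EFinM; exact: c_row_sup_le cE cov.
  have m1 k : 1 * alphabar A k = alphabar A k by rewrite mul1r.
  split=> //; first exact: (@op_mnc_le R _ A (alphabar A) 1).
  split=> [cA|]; last exact: (@compact_of_cvg R _ A (alphabar A) 1).
  apply: limn_esup_le_cvg; last exact: row_sup_ge0.
  (* Writing 0 as 2 times 0 brings in the factor 1/2 of the lower bound. *)
  rewrite -(mule0 2%:E) -lee_pdivrMl //.
  apply: (le_trans le); apply: totally_bounded_mnc; apply: cA.
  by split=> [x []//|]; exists 1 => x [_ ->].
Qed.
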